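(* Let $d,D\in\mathbb{N}$, and for each site $n\in\mathbb{N}=\{1,2,\dots\}$ let $A^{[n]}_1,\dots,A^{[n]}_d\in\mathbb{M}_D(\mathbb{C})$. Let $\Phi_n(M)=\sum_{i=1}^d A_i^{[n]\dagger} M A_i^{[n]}$ for $M\in\mathbb{M}_D(\mathbb{C})$. Suppose that for all $n\in\mathbb{N}$ and all $i\in\{1,\dots,d\}$ $$\sum_{j=1}^d A_{j}^{[n+1]\dagger} A_{i}^{[n]\dagger}\otimes A_{i}^{[n]}A_{j}^{[n+1]}=A_{i}^{[n]\dagger}\otimes A_{i}^{[n]}.$$ Then: (1) For every $n\in\mathbb{N}$ and every completely positive map $\Phi:\mathbb{M}_D(\mathbb{C})\to\mathbb{M}_D(\mathbb{C})$, $$\operatorname{Tr}(\Phi_{n+1}\circ\Phi_n\circ\Phi)=\operatorname{Tr}(\Phi_n\circ\Phi),$$ where $\operatorname{Tr}$ is the trace of a superoperator. (2) The sequence of states $\{\varphi_n\}_{n\ge 1}$ given by $\varphi_n(X)=\dfrac{\langle\Psi_{n+1}|X\otimes\mathbf{1}_{n+1}|\Psi_{n+1}\rangle}{\langle\Psi_{n+1}|\Psi_{n+1}\rangle}$, $X\in\mathcal{B}_{[1,n]}$, is projective. (3) For every $N\in\mathbb{N}$ and every $X\in\mathcal{B}_{[1,N]}$ the limit $$\varphi(X):=\lim_{n\to\infty}\frac{\langle\Psi_n|X\otimes\mathbf{1}|\Psi_n\rangle}{\langle\Psi_n|\Psi_n\rangle}$$ exists and equals $\dfrac{\operatorname{Tr}(\Phi_{N+1}\circ\hat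 X)}{\operatorname{Tr}(\Phi_1)}$, and this defines a state $\varphi$ on $\mathcal{B}_{\mathbb{N}}$.
   Context: $\mathcal{H}$ is a $d$-dimensional Hilbert space with orthonormal basis $\{|i\rangle\}_{i=1}^d$. $\mathcal{B}_{[1,n]}=\mathcal{B}(\mathcal{H})^{\otimes n}\cong\mathcal{B}(\mathcal{H}^{\otimes n})$ is embedded in $\mathcal{B}_{[1,n+1]}$ by $X\mapsto X\otimes\mathbf{1}_{n+1}$. $\mathcal{B}_{\mathbb{N}}=\bigotimes_{n\in\mathbb{N}}\mathcal{B}(\mathcal{H})$ is the infinite tensor product C$^*$-algebra, i.e. the C$^*$-norm closure of the local algebra $\bigcup_n\mathcal{B}_{[1,n]}$. A state is a positive linear functional $\varphi$ with $\varphi(\mathbf{1})=1$; a functional given on the local algebra ''defines a state on $\mathcal{B}_{\mathbb{N}}$'' if it extends to a state of $\mathcal{B}_{\mathbb{N}}$. Matrix product vectors: $$|\Psi_n\rangle=\sum_{i_1,\dots,i_n=1}^d\operatorname{Tr}(A^{[1]}_{i_1}A^{[2]}_{i_2}\cdots A^{[n]}_{i_n})\,|i_1,\dots,i_n\rangle\in\mathcal{H}^{\otimes n},$$ with the usual (unnormalized) matrix trace. It is assumed that $\langle\Psi_n|\Psi_n\rangle\neq0$ for all $n$, so that the expectation functionals are defined. In $\langle\Psi_n|X\otimes\mathbf{1}|\Psi_n\rangle$ with $X\in\mathcal{B}_{[1,N]}$, $n\geq N$, the operator $\mathbf{1}$ is the identity on sites $N+1,\dots,n$. Trace of a superoperator: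 for a linear map $\Phi:\mathbb{M}_D(\mathbb{C})\to\mathbb{M}_D(\mathbb{C})$, $\operatorname{Tr}(\Phi)=\sum_{k,l=1}^D\langle e_k|\Phi(|e_k\rangle\langle e_l|)|e_l\rangle$, with $\{e_k\}$ the standard basis of $\mathbb{C}^D$. For $X\in\mathcal{B}_{[1,N]}$, $\hat X:\mathbb{M}_D(\mathbb{C})\to\mathbb{M}_D(\mathbb{C})$ is the linear map $$\hat X(M)=\sum_{\substack{i_1,\dots,i_N\\ j_1,\dots,j_N}}\langle i_1,\dots,i_N|X|j_1,\dots,j_N\rangle\,A_{i_N}^{[N]\dagger}\cdots A_{i_1}^{[1]\dagger}\,M\,A_{j_1}^{[1]}\cdots A_{j_N}^{[N]}.$$ A sequence $(\varphi_n)_n$ is projective if each $\varphi_n$ is a state on $\mathcal{B}_{[1,n]}$ and $\varphi_{n+1}|_{\mathcal{B}_{[1,n]}}=\varphi_n$ for all $n$ (i.e. $\varphi_{n+1}(X\otimes\mathbf{1}_{n+1})=\varphi_n(X)$ for $X\in\mathcal{B}_{[1,n]}$). *)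

(* Defs.v *)
From HB Require Import structures.
From mathcomp Require Import all_boot all_order all_algebra.
From mathcomp Require Import complex mxtens ring_quotient.
From mathcomp Require Import all_classical all_reals all_analysis.

Set Implicit Arguments.
Unset Strict Implicit.
Unset Printing Implicit Defensive.

Import Order.TTheory GRing.Theory Num.Theory.
Import numFieldNormedType.Exports.

Local Open Scope ring_scope.
Local Open Scope classical_set_scope.
Local Open Scope quotient_scope.

Notation "A ^H" := (map_mx Num.conj (trmx A))
  (at level 8, format "A ^H") : ring_scope.

(* Unital *-algebras over C. The library's [algType] excludes the zero ring,
   hence also 'M_n for a variable n; the product is therefore a field of this
   structure rather than the one of a ring structure. *)
HB.mixin Record isStarAlgebra (C : numClosedFieldType) V
    of GRing.Lmodule C V := {
  amul : V -> V -> V;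
  aone : V;
  adj : V -> V;
  amulA : associative amul;
  amul1l : left_id aone amul;
  amul1r : right_id aone amul;
  amulDl : left_distributive amul +%R;
  amulDr : right_distributive amul +%R;
  amulZl : forall (a : C) (x y : V), amul (a *: x) y = a *: amul x y;
  amulZr : forall (a : C) (x y : V), amul x (a *: y) = a *: amul x y;
  adjK : involutive adj;
  adjD : {morph adj : x y / x + y};
  adjZ : forall (a : C) (x : V), adj (a *: x) = a^* *: adj x;
  adjM : forall x y : V, adj (amul x y) = amul (adj y) (adj x)
}.

#[short(type="starAlgType")]
HB.structure Definition StarAlgebra (C : numClosedFieldType) :=
  {V of GRing.Lmodule C V & isStarAlgebra C V}.

Section State.
Variables (C : numClosedFieldType) (V : starAlgType C).

Definition is_state (phi : V -> C) : Prop :=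
  [/\ scalar phi, forall x, 0 <= phi (amul (adj x) x) & phi aone = 1].

End State.

Section MatrixStar.
Variables (C : numClosedFieldType) (n : nat).
Implicit Types A B : 'M[C]_n.

Let mxadj A : 'M[C]_n := A^H.

Fact mxadjK : involutive mxadj.
Proof. by move=> A; apply/matrixP => i j; rewrite !mxE conjCK. Qed.
Fact mxadjD : {morph mxadj : A B / A + B}.
Proof. by move=> A B; apply/matrixP => i j; rewrite !mxE rmorphD. Qed.
Fact mxadjZ (a : C) A : mxadj (a *: A) = a^* *: mxadj A.
Proof. by apply/matrixP => i j; rewrite !mxE rmorphM. Qed.
Fact mxadjM A B : mxadj (A *m B) = mxadj B *m mxadj A.
Proof. by rewrite /mxadj trmx_mul map_mxM. Qed.

HB.instance Definition _ := isStarAlgebra.Build C 'M[C]_n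
  (@mulmxA C n n n n) (@mul1mx C n n) (@mulmx1 C n n)
  (@mulmxDl C n n n) (@mulmxDr C n n n)
  (fun a A B => esym (scalemxAl a A B)) (fun a A B => esym (scalemxAr a A B))
  mxadjK mxadjD mxadjZ mxadjM.

End MatrixStar.

(* Basis labels |i_1, ..., i_n> of H^{(x) n}; site k+1 is the ordinal k. *)
Notation config d n := {ffun 'I_n -> 'I_d}.

(* B_[1,n] = B(H^{(x) n}), as matrices in the basis of configurations:
   <i|X|j> is [X (enum_rank i) (enum_rank j)]. *)
Notation obs R d n := 'M[R[i]]_#|config d n|.

Section OperatorNorm.
Variable R : realType.

Definition vnorm m (v : 'cV[R[i]]_m) : R :=
  Num.sqrt (complex.Re ((v^H *m v) 0 0)).

Definition opnorm m (X : 'M[R[i]]_m) : R :=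
  sup [set vnorm (X *m v) | v in [set v | vnorm v <= 1]].

End OperatorNorm.

Section Amplify.
Variables (R : realType) (d : nat).

Definition restrict m n (le_mn : (m <= n)%N) (i : config d n) : config d m :=
  [ffun k => i (widen_ord le_mn k)].

(* X (x) 1, the identity acting on the sites m+1, ..., n. *)
Definition amplify m n (le_mn : (m <= n)%N) (X : obs R d m) : obs R d n :=
  \matrix_(a, b)
    let i := enum_val a in let j := enum_val b in
    X (enum_rank (restrict le_mn i)) (enum_rank (restrict le_mn j))
      * [forall k : 'I_n, (m <= k)%N ==> (i k == j k)]%:R.

End Amplify.

Section VnormTheory.
Variable R : realType.
Local Notation C := R[i].
Implicit Types m n : nat.

Let normC_sqr (z : C) : `|z| ^+ 2 = (complex.Re `|z| ^+ 2)%:C%C.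
Proof. by rewrite normc_def /= rmorphXn. Qed.

Fact vnorm_sumE m (v : 'cV[C]_m) :
  (v^H *m v) 0 0 = \sum_i `|v i 0| ^+ 2.
Proof. by rewrite mxE; apply: eq_bigr => i _; rewrite !mxE mulrC -normCK. Qed.

Fact vnormE m (v : 'cV[C]_m) : (vnorm v)%:C%C = sqrtC ((v^H *m v) 0 0).
Proof.
have v0 : 0 <= (v^H *m v) 0 0 by rewrite vnorm_sumE sumr_ge0.
have e : (complex.Re ((v^H *m v) 0 0))%:C%C = (v^H *m v) 0 0.
  by rewrite RRe_real // ger0_real.
have r0 : 0 <= complex.Re ((v^H *m v) 0 0) by rewrite -lecR e.
rewrite /vnorm -[in RHS]e; apply/eqP.
rewrite -(@eqrXn2 _ 2) ?sqrtC_ge0 ?lecR ?sqrtr_ge0 //.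
by rewrite sqrtCK -rmorphXn /= sqr_sqrtr.
Qed.

Fact vnorm_sqr m (v : 'cV[C]_m) : (vnorm v ^+ 2)%:C%C = \sum_i `|v i 0| ^+ 2.
Proof. by rewrite rmorphXn /= vnormE sqrtCK vnorm_sumE. Qed.

Fact vnorm_ge0 m (v : 'cV[C]_m) : 0 <= vnorm v.
Proof. exact: sqrtr_ge0. Qed.

Fact vnormD m (u v : 'cV[C]_m) : vnorm (u + v) <= vnorm u + vnorm v.
Proof.
rewrite -lecR rmorphD /= !vnormE.
have tr (w : 'cV[C]_m) : (w^H *m w) 0 0 = dotmx w^T w^T.
  by rewrite dotmxE trmxK !mxE; apply: eq_bigr => i _; rewrite !mxE mulrC.
rewrite !tr linearD /=.
by have [] := triangle_lerif (@dotmx C m) u^T v^T.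
Qed.

Fact vnormZ m (a : C) (v : 'cV[C]_m) : vnorm (a *: v) = complex.Re `|a| * vnorm v.
Proof.
apply/(@eqP R); rewrite -(@eqrXn2 _ 2) ?mulr_ge0 ?vnorm_ge0 //; last first.
  by rewrite normc_def /= sqrtr_ge0.
apply/eqP; apply: complexI; rewrite vnorm_sqr exprMn rmorphM /= vnorm_sqr.
rewrite -normC_sqr mulr_sumr; apply: eq_bigr => i _.
by rewrite mxE normrM exprMn.
Qed.

Fact vnorm0 m : vnorm (0 : 'cV[C]_m) = 0.
Proof. by rewrite -(scale0r 0) vnormZ normr0 /= mul0r. Qed.

Fact vnorm_eq0 m (v : 'cV[C]_m) : vnorm v = 0 -> v = 0.
Proof.
move=> v0; have := vnorm_sqr v; rewrite v0 expr0n /= => /esym/eqP.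
rewrite psumr_eq0 => [/allP h|i _]; last exact: exprn_ge0.
apply/colP => i; rewrite mxE; apply/eqP.
by have := h i (mem_index_enum _); rewrite sqrf_eq0 normr_eq0.
Qed.

Fact vnorm_sum m (I : finType) (F : I -> 'cV[C]_m) :
  vnorm (\sum_i F i) <= \sum_i vnorm (F i).
Proof.
elim/big_ind2: _ => [|a b c e ab ce|//]; first by rewrite vnorm0.
exact: le_trans (vnormD _ _) (lerD ab ce).
Qed.

Fact vnorm_coord m (v : 'cV[C]_m) i : complex.Re `|v i 0| <= vnorm v.
Proof.
rewrite -(@ler_sqr R) ?nnegrE ?vnorm_ge0 //; last first.
  by rewrite normc_def /= sqrtr_ge0.
rewrite -lecR -normC_sqr vnorm_sqr (bigD1 i) //= lerDl; apply: sumr_ge0 => j _; exact: exprn_ge0 (normr_ge0 _).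
Qed.

Fact vnorm_mulmx_bound m n (X : 'M[C]_(n, m)) (v : 'cV[C]_m) :
  vnorm (X *m v) <= (\sum_j vnorm (col j X)) * vnorm v.
Proof.
have -> : X *m v = \sum_j v j 0 *: col j X.
  apply/colP => i; rewrite mxE summxE; apply: eq_bigr => j _.
  by rewrite !mxE mulrC.
rewrite mulr_suml (le_trans (vnorm_sum _)) // ler_sum // => j _.
by rewrite vnormZ mulrC ler_wpM2l ?vnorm_ge0 ?vnorm_coord.
Qed.

Let opset m (X : 'M[C]_m) := [set vnorm (X *m v) | v in [set v | vnorm v <= 1]].

Let opset_sup m (X : 'M[C]_m) : has_sup (opset X).
Proof.
split; first by exists (vnorm (X *m 0)); exists 0 => //=; rewrite vnorm0.
exists (\sum_j vnorm (col j X)) => _ [v /= v1 <-].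
apply: le_trans (vnorm_mulmx_bound X v) _.
by rewrite ler_piMr // sumr_ge0 // => j _; exact: vnorm_ge0.
Qed.

Fact opnorm_ge0 m (X : 'M[C]_m) : 0 <= opnorm X.
Proof.
apply: (le_trans (vnorm_ge0 (X *m 0))); apply: ub_le_sup.
  by have [] := opset_sup X.
by exists 0 => //=; rewrite vnorm0.
Qed.

Fact vnorm_mulmx m (X : 'M[C]_m) (v : 'cV[C]_m) :
  vnorm (X *m v) <= opnorm X * vnorm v.
Proof.
have [v0|v0] := eqVneq (vnorm v) 0.
  by rewrite (vnorm_eq0 v0) mulmx0 vnorm0 mulr0.
have vp : 0 < vnorm v by rewrite lt_def v0 vnorm_ge0.
pose c : C := ((vnorm v)^-1)%:C%C.
have cE : complex.Re `|c| = (vnorm v)^-1.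
  by rewrite ger0_norm ?ler0c ?invr_ge0 ?vnorm_ge0.
rewrite -ler_pdivrMr // mulrC -cE -vnormZ scalemxAr.
apply: ub_le_sup; first by have [] := opset_sup X.
by exists (c *: v) => //=; rewrite vnormZ cE mulVf.
Qed.

Fact opnorm_le m (X : 'M[C]_m) (c : R) : 0 <= c ->
  (forall v : 'cV[C]_m, vnorm (X *m v) <= c * vnorm v) -> opnorm X <= c.
Proof.
move=> c0 h; apply: ge_sup; first by have [] := opset_sup X.
by move=> _ [v /= v1 <-]; apply: le_trans (h v) _; rewrite ler_piMr.
Qed.

Fact opnorm0 m : opnorm (0 : 'M[C]_m) = 0.
Proof.
apply/eqP; rewrite eq_le opnorm_ge0 andbT; apply: opnorm_le => // v.
by rewrite mul0mx vnorm0 mul0r.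
Qed.

Fact opnormD m (X Y : 'M[C]_m) : opnorm (X + Y) <= opnorm X + opnorm Y.
Proof.
apply: opnorm_le => [|v]; first by rewrite addr_ge0 ?opnorm_ge0.
rewrite mulmxDl mulrDl (le_trans (vnormD _ _)) //.
by rewrite lerD // vnorm_mulmx.
Qed.

Fact opnormZ m (a : C) (X : 'M[C]_m) :
  opnorm (a *: X) <= complex.Re `|a| * opnorm X.
Proof.
have a0 : 0 <= complex.Re `|a| by rewrite normc_def /= sqrtr_ge0.
apply: opnorm_le => [|v]; first by rewrite mulr_ge0 ?opnorm_ge0.
by rewrite -scalemxAl vnormZ -mulrA ler_wpM2l // vnorm_mulmx.
Qed.

Fact opnormN m (X : 'M[C]_m) : opnorm (- X) <= opnorm X.
Proof.
by rewrite -scaleN1r (le_trans (opnormZ _ _)) // normrN1 /= mul1r.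
Qed.

Fact opnormM m (X Y : 'M[C]_m) : opnorm (X *m Y) <= opnorm X * opnorm Y.
Proof.
apply: opnorm_le => [|v]; first by rewrite mulr_ge0 ?opnorm_ge0.
rewrite -mulmxA (le_trans (vnorm_mulmx _ _)) // -mulrA.
by rewrite ler_wpM2l ?opnorm_ge0 // vnorm_mulmx.
Qed.

Fact opnormH m (X : 'M[C]_m) : opnorm X^H <= opnorm X.
Proof.
apply: opnorm_le => [|v]; first exact: opnorm_ge0.
have [w0|w0] := eqVneq (vnorm (X^H *m v)) 0.
  by rewrite w0 mulr_ge0 ?opnorm_ge0 ?vnorm_ge0.
have wp : 0 < vnorm (X^H *m v) by rewrite lt_def w0 vnorm_ge0.
rewrite -(ler_pM2r wp) -lecR !rmorphM /= [X in X * X]vnormE -expr2 sqrtCK.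
set w := X^H *m v.
have -> : (w^H *m w) 0 0 = `|(v^H *m (X *m w)) 0 0|.
  have wE : w^H = v^H *m X.
    by rewrite /w trmx_mul map_mxM; congr mulmx; exact: mxadjK.
  have <- : w^H *m w = v^H *m (X *m w) by rewrite wE; exact: esym (mulmxA _ _ _).
  by rewrite ger0_norm // vnorm_sumE sumr_ge0 // => i _; exact: exprn_ge0.
have cs : `|(v^H *m (X *m w)) 0 0| <= ((vnorm v) * vnorm (X *m w))%:C%C.
  rewrite rmorphM /= !vnormE.
  have tr (a b : 'cV[C]_m) : (a^H *m b) 0 0 = dotmx b^T a^T.
    by rewrite dotmxE trmxK !mxE; apply: eq_bigr => i _; rewrite !mxE mulrC.
  rewrite !tr; have [+ _] := CauchySchwarz_sqrt (@dotmx C m) (X *m w)^T v^T.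
  by rewrite mulrC.
apply: le_trans cs _.
rewrite -!rmorphM lecR mulrAC [leRHS]mulrC ler_wpM2l ?vnorm_ge0 //.
exact: vnorm_mulmx.
Qed.


End VnormTheory.

Section AmplifyTheory.
Variables (R : realType) (d : nat).
Local Notation C := R[i].
Implicit Types m n : nat.

Let sumK n (F : 'I_#|config d n| -> C) : \sum_a F a = \sum_i F (enum_rank i).
Proof. by rewrite (reindex _ (onW_bij _ (@enum_rank_bij _))). Qed.

(* [glue q i] agrees with [q] on the first m sites and with [i] afterwards. *)
Definition glue m n (q : config d m) (i : config d n) : config d n :=
  [ffun k : 'I_n => if insub (val k) is Some k' then q k' else i k].

Section Fixed.
Variables (m n : nat) (le_mn : (m <= n)%N).
Local Notation res := (restrict le_mn).
Implicit Types (p q : config d m) (i j : config d n).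

Let tail_eq i j := [forall k : 'I_n, (m <= k)%N ==> (i k == j k)].

Fact res_glue q i : res (glue q i) = q.
Proof.
apply/ffunP => k; rewrite !ffunE.
by case: insubP => [k' _ /val_inj-> //|]; rewrite /= ltn_ord.
Qed.

Fact glue_res i j : tail_eq i j -> glue (res i) j = i.
Proof.
move=> /forallP ij; apply/ffunP => k; rewrite ffunE.
case: insubP => [k' _ kk'|]; first by rewrite ffunE; congr (i _); exact: val_inj.
by rewrite -leqNgt => mk; have := ij k; rewrite mk => /eqP.
Qed.

Fact glue_glue p q i : glue p (glue q i) = glue p i.
Proof. by apply/ffunP => k; rewrite !ffunE; case: insubP. Qed.

Fact tail_glue q i : tail_eq i (glue q i).
Proof.
apply/forallP => k; apply/implyP => mk; rewrite ffunE.
by case: insubP => // k'; rewrite ltnNge mk.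
Qed.

Fact amplifyE (X : obs R d m) i j :
  amplify le_mn X (enum_rank i) (enum_rank j) =
  X (enum_rank (res i)) (enum_rank (res j)) * (tail_eq i j)%:R.
Proof. by rewrite mxE !enum_rankK. Qed.

Fact sum_tail i (F : config d n -> C) :
  \sum_j F j * (tail_eq i j)%:R = \sum_(q : config d m) F (glue q i).
Proof.
rewrite (bigID (tail_eq i)) /= [X in _ + X]big1 ?addr0; last first.
  by move=> j /negbTE->; rewrite mulr0.
rewrite (reindex (fun q : config d m => glue q i)) /=; last first.
  exists res => [q _|j ij]; first exact: res_glue.
  apply: glue_res; rewrite inE in ij.
  by apply/forallP => k; rewrite eq_sym; exact: (forallP ij k).
under eq_bigl do rewrite tail_glue.
by apply: eq_bigr => q _; rewrite tail_glue mulr1.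
Qed.

Fact amplify_sum s (X : obs R d m) (V : 'M[C]_(_, s)) i b :
  (amplify le_mn X *m V) (enum_rank i) b =
  \sum_q X (enum_rank (res i)) (enum_rank q) * V (enum_rank (glue q i)) b.
Proof.
rewrite mxE sumK; under eq_bigr do rewrite amplifyE mulrAC.
by rewrite sum_tail; apply: eq_bigr => q _; rewrite res_glue.
Qed.

Fact amplifyD : {morph @amplify R d _ _ le_mn : X Y / X + Y}.
Proof. by move=> X Y; apply/matrixP => a b; rewrite !mxE /= ?mxE mulrDl. Qed.

Fact amplifyZ (a : C) (X : obs R d m) : amplify le_mn (a *: X) = a *: amplify le_mn X.
Proof. by apply/matrixP => i j; rewrite !mxE /= ?mxE mulrA. Qed.

Fact amplifyN (X : obs R d m) : amplify le_mn (- X) = - amplify le_mn X :> obs R d n.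
Proof. by rewrite -scaleN1r amplifyZ scaleN1r. Qed.

Fact amplify0 : amplify le_mn 0 = 0 :> obs R d n.
Proof. by rewrite -(scale0r 0) amplifyZ scale0r. Qed.

Fact tail_eqC i j : tail_eq i j = tail_eq j i.
Proof. by apply: eq_forallb => k; rewrite eq_sym. Qed.

Fact amplifyH (X : obs R d m) : amplify le_mn X^H = (amplify le_mn X)^H.
Proof.
apply/matrixP => a b; rewrite -[a]enum_valK -[b]enum_valK amplifyE.
by rewrite 2![in RHS]mxE amplifyE !mxE tail_eqC rmorphM /= conjC_nat.
Qed.

Fact amplify1 : amplify le_mn 1%:M = 1%:M :> obs R d n.
Proof.
apply/matrixP => a b; rewrite -[a]enum_valK -[b]enum_valK amplifyE !mxE.
move: (enum_val a) (enum_val b) => i j.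
rewrite !(inj_eq enum_rank_inj) -natrM mulnb; congr (_%:R : C); congr nat_of_bool.
apply/andP/eqP => [[/eqP rij tij]|->]; last by split=> //; apply/forallP => k; rewrite eqxx implybT.
rewrite -(glue_res tij) rij; apply: glue_res.
by apply/forallP => k; rewrite eqxx implybT.
Qed.

Fact amplifyM (X Y : obs R d m) :
  amplify le_mn (X *m Y) = amplify le_mn X *m amplify le_mn Y.
Proof.
apply/matrixP => a b; rewrite -[a]enum_valK -[b]enum_valK amplify_sum amplifyE.
move: (enum_val a) (enum_val b) => i j.
rewrite mxE sumK mulr_suml; apply: eq_bigr => q _.
rewrite amplifyE res_glue mulrA; congr (_ * _%:R); congr nat_of_bool.
apply: eq_forallb => k; case: leqP => //= mk; rewrite ffunE.
by case: insubP => // k'; rewrite ltnNge mk.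
Qed.

Fact opnorm_amplify (X : obs R d m) : opnorm (amplify le_mn X) <= opnorm X.
Proof.
apply: opnorm_le => [|v]; first exact: opnorm_ge0.
pose K := #|config d m|.
pose slice i : 'cV[C]_#|config d m| := \col_a v (enum_rank (glue (enum_val a) i)) 0.
have avg (F : config d n -> C) : \sum_i \sum_(q : config d m) F (glue q i) = K%:R * \sum_i F i.
  rewrite pair_big /= (reindex (fun x : config d n * config d m => (glue x.2 x.1, res x.1))) /=; last first.
    exists (fun x : config d n * config d m => (glue x.2 x.1, res x.1)) => -[i q] _ /=;
      by rewrite res_glue glue_glue glue_res //; apply/forallP => k; rewrite eqxx implybT.
  under eq_bigr => x _.
    rewrite glue_glue glue_res; last by apply/forallP => k; rewrite eqxx implybT.
    over.
  rewrite -(pair_big xpredT xpredT (fun i (_ : config d m) => F i)) /= mulr_sumr.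
  by apply: eq_bigr => i _; rewrite sumr_const mulr_natl.
have [K0|K0] := posnP K.
  have e0 : vnorm (amplify le_mn X *m v) = 0.
    suff -> : amplify le_mn X *m v = 0 by rewrite vnorm0.
    apply/colP => a; have := fintype0 (res (enum_val a)); by rewrite -/K K0.
  by rewrite e0 mulr_ge0 ?opnorm_ge0 ?vnorm_ge0.
have sl i (q : config d m) : slice (glue q i) = slice i.
  by apply/colP => a; rewrite !mxE glue_glue.
have KE s (w : 'cV[C]_#|config d s|) :
    (K%:R * vnorm w ^+ 2)%:C%C = K%:R * \sum_i `|w (enum_rank i) 0| ^+ 2 :> C.
  by rewrite [LHS]rmorphM /= rmorph_nat vnorm_sqr sumK.
have big : (K%:R * vnorm (amplify le_mn X *m v) ^+ 2)%:C%C <=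
           (K%:R * (opnorm X * vnorm v) ^+ 2)%:C%C :> C.
  have -> : K%:R * (opnorm X * vnorm v) ^+ 2 =
      opnorm X ^+ 2 * (K%:R * vnorm v ^+ 2) by rewrite exprMn mulrCA.
  rewrite [leRHS]rmorphM [leRHS]/= !KE -!avg mulr_sumr; apply: ler_sum => i _.
  have -> : \sum_(q : config d m)
      `|(amplify le_mn X *m v) (enum_rank (glue q i)) 0| ^+ 2 =
      (vnorm (X *m slice i) ^+ 2)%:C%C.
    rewrite vnorm_sqr sumK; apply: eq_bigr => q _; congr (`|_| ^+ 2).
    rewrite amplify_sum res_glue mxE sumK; apply: eq_bigr => q' _.
    by rewrite mxE enum_rankK glue_glue.
  have -> : \sum_(q : config d m) `|v (enum_rank (glue q i)) 0| ^+ 2 =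
      (vnorm (slice i) ^+ 2)%:C%C.
    by rewrite vnorm_sqr sumK; apply: eq_bigr => q _; rewrite mxE enum_rankK.
  rewrite -rmorphM lecR -exprMn ler_sqr ?nnegrE ?vnorm_ge0 ?vnorm_mulmx //.
  by rewrite mulr_ge0 ?opnorm_ge0 ?vnorm_ge0.
move: big; rewrite lecR ler_pM2l ?ltr0n // ler_sqr ?nnegrE ?vnorm_ge0 //.
by rewrite mulr_ge0 ?opnorm_ge0 ?vnorm_ge0.
Qed.

End Fixed.

Fact amplify_comp m n p (le_mn : (m <= n)%N) (le_np : (n <= p)%N) (le_mp : (m <= p)%N)
    (X : obs R d m) : amplify le_np (amplify le_mn X) = amplify le_mp X.
Proof.
apply/matrixP => a b; rewrite -[a]enum_valK -[b]enum_valK !amplifyE.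
move: (enum_val a) (enum_val b) => i j.
have rr (k : config d p) : restrict le_mn (restrict le_np k) = restrict le_mp k.
  by apply/ffunP => s; rewrite !ffunE; congr (k _); exact: val_inj.
rewrite !rr -mulrA -natrM mulnb; congr (_ * _%:R); congr nat_of_bool.
apply/andP/forallP => [[/forallP h1 /forallP h2] k|h].
  apply/implyP => mk; have [nk|kn] := leqP n k; first exact: (implyP (h2 k)).
  have := h1 (Ordinal kn); rewrite /= mk !ffunE.
  by congr (i _ == j _); exact: val_inj.
split; apply/forallP => k; apply/implyP => mk.
  by rewrite !ffunE; exact: (implyP (h (widen_ord le_np k))).
by apply: (implyP (h k)); exact: leq_trans mk.
Qed.

Fact amplify_id m (le_mm : (m <= m)%N) (X : obs R d m) : amplify le_mm X = X.
Proof.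
apply/matrixP => a b; rewrite -[a]enum_valK -[b]enum_valK amplifyE.
have rr (k : config d m) : restrict le_mm k = k.
  by apply/ffunP => s; rewrite !ffunE; congr (k _); exact: val_inj.
rewrite !rr; case: forallP => [_|]; first by rewrite mulr1.
by case=> k; rewrite leqNgt ltn_ord.
Qed.

End AmplifyTheory.

Section CauchySequence.
Variables (R : realType) (d : nat).
Local Notation C := R[i].
Implicit Types m n : nat.

(* A quasi-local sequence x_n \in B_[1,n] is one with
   lim_N sup_(n >= m >= N) ||x_n - x_m (x) 1|| = 0, ||.|| the operator norm;
   equivalently, the x_n form a Cauchy sequence of the local algebra. *)
Definition ql_cauchy (x : forall n, obs R d n) : Prop :=
  forall e : R, 0 < e -> exists N, forall m n (le_mn : (m <= n)%N),
    (N <= m)%N -> opnorm (x n - amplify le_mn (x m)) <= e.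

Record qlseq := QlSeq {
  qlval :> forall n, obs R d n;
  qlvalP : ql_cauchy qlval
}.

Fact qlseq_eq (x y : qlseq) : (forall n, x n = y n) -> x = y.
Proof.
case: x y => [x xP] [y yP] /= xy; have e := functional_extensionality_dep xy.
by subst y; congr QlSeq; exact: Prop_irrelevance.
Qed.

HB.instance Definition _ := gen_eqMixin qlseq.
HB.instance Definition _ := gen_choiceMixin qlseq.

Fact ql_bounded (x : qlseq) :
  exists2 b : R, 0 < b & exists N, forall n, (N <= n)%N -> opnorm (x n) <= b.
Proof.
have [N hN] := qlvalP x ltr01; exists (1 + opnorm (x N)).
  by rewrite ltr_pwDl ?opnorm_ge0.
exists N => n le_Nn; rewrite -[x n](subrK (amplify le_Nn (x N))).
apply: le_trans (opnormD _ _) _.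
by apply: lerD; [exact: hN|exact: opnorm_amplify].
Qed.

Fact ql_zeroP : ql_cauchy (fun=> 0).
Proof.
by move=> e e0; exists 0 => m n le_mn _; rewrite amplify0 subrr opnorm0 ltW.
Qed.

Fact ql_oneP : ql_cauchy (fun=> 1%:M).
Proof.
by move=> e e0; exists 0 => m n le_mn _; rewrite amplify1 subrr opnorm0 ltW.
Qed.

Fact ql_addP (x y : qlseq) : ql_cauchy (fun n => x n + y n).
Proof.
move=> e e0; have e2 : 0 < e / 2 by rewrite divr_gt0.
have [N hN] := qlvalP x e2; have [M hM] := qlvalP y e2.
exists (maxn N M) => m n le_mn; rewrite geq_max => /andP[Nm Mm].
rewrite amplifyD opprD addrACA; apply: le_trans (opnormD _ _) _.
by rewrite [leRHS]splitr; apply: lerD; [exact: hN|exact: hM].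
Qed.

Fact ql_scaleP (a : C) (x : qlseq) : ql_cauchy (fun n => a *: x n).
Proof.
move=> e e0; pose k := complex.Re `|a| + 1.
have k0 : 0 < k by rewrite ltr_pwDr // normc_def /= sqrtr_ge0.
have [N hN] := qlvalP x (divr_gt0 e0 k0).
exists N => m n le_mn Nm; rewrite amplifyZ -scalerBr.
apply: le_trans (opnormZ _ _) _.
apply: le_trans (_ : k * (e / k) <= _); last by rewrite mulrC divfK ?gt_eqF.
apply: ler_pM; [|exact: opnorm_ge0|by rewrite lerDl|exact: hN].
by rewrite normc_def /= sqrtr_ge0.
Qed.

Fact ql_oppP (x : qlseq) : ql_cauchy (fun n => - x n).
Proof.
move=> e e0; have [N hN] := qlvalP x e0; exists N => m n le_mn Nm.
by rewrite amplifyN -opprD; apply: le_trans (opnormN _) _; exact: hN.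
Qed.

Fact ql_adjP (x : qlseq) : ql_cauchy (fun n => adj (x n)).
Proof.
move=> e e0; have [N hN] := qlvalP x e0; exists N => m n le_mn Nm.
have -> : adj (x n) - amplify le_mn (adj (x m)) =
    (x n - amplify le_mn (x m))^H.
  by rewrite [amplify _ _]amplifyH; apply/matrixP => i j; rewrite !mxE rmorphB.
by apply: le_trans (opnormH _) _; exact: hN.
Qed.

Fact ql_mulP (x y : qlseq) : ql_cauchy (fun n => x n *m y n).
Proof.
move=> e e0.
have [b b0 [B hB]] := ql_bounded x; have [c c0 [D hD]] := ql_bounded y.
have eb : 0 < e / 2 / b by rewrite !divr_gt0.
have ec : 0 < e / 2 / c by rewrite !divr_gt0.
have [N hN] := qlvalP x ec; have [M hM] := qlvalP y eb.
exists (maxn (maxn N M) (maxn B D)) => m n le_mn.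
rewrite !geq_max => /andP[/andP[Nm Mm] /andP[Bm Dm]].
rewrite amplifyM; set X := amplify _ _; set Y := amplify _ _.
have -> : x n *m y n - X *m Y = (x n - X) *m y n + X *m (y n - Y).
  by rewrite mulmxBl mulmxBr addrA subrK.
apply: le_trans (opnormD _ _) _; rewrite [leRHS]splitr; apply: lerD.
  apply: le_trans (opnormM _ _) _; rewrite -[leRHS](divfK (lt0r_neq0 c0)).
  apply: ler_pM; [exact: opnorm_ge0|exact: opnorm_ge0|exact: hN|].
  by apply: hD; exact: leq_trans Dm le_mn.
apply: le_trans (opnormM _ _) _; rewrite -[leRHS](divfK (lt0r_neq0 b0)) mulrC.
apply: ler_pM; [exact: opnorm_ge0|exact: opnorm_ge0|exact: hM|].
by apply: le_trans (opnorm_amplify _ _) _; exact: hB.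
Qed.

Definition ql_zero := QlSeq ql_zeroP.
Definition ql_one := QlSeq ql_oneP.
Definition ql_add x y := QlSeq (ql_addP x y).
Definition ql_opp x := QlSeq (ql_oppP x).
Definition ql_scale a x := QlSeq (ql_scaleP a x).
Definition ql_adj x := QlSeq (ql_adjP x).
Definition ql_mul x y := QlSeq (ql_mulP x y).

Fact ql_addA : associative ql_add.
Proof. by move=> x y z; apply: qlseq_eq => n; exact: addrA. Qed.
Fact ql_addC : commutative ql_add.
Proof. by move=> x y; apply: qlseq_eq => n; exact: addrC. Qed.
Fact ql_add0 : left_id ql_zero ql_add.
Proof. by move=> x; apply: qlseq_eq => n; exact: add0r. Qed.
Fact ql_addN : left_inverse ql_zero ql_opp ql_add.
Proof. by move=> x; apply: qlseq_eq => n; exact: addNr. Qed.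

HB.instance Definition _ :=
  GRing.isZmodule.Build qlseq ql_addA ql_addC ql_add0 ql_addN.

Definition ql_null : {pred qlseq} := fun x => `[< forall e : R, 0 < e ->
  exists N, forall n, (N <= n)%N -> opnorm (x n) <= e >].

Fact ql_null_zmod : zmod_closed ql_null.
Proof.
split=> [|x y /asboolP xP /asboolP yP]; apply/asboolP => e e0.
  by exists 0 => n _; rewrite opnorm0 ltW.
have e2 : 0 < e / 2 by rewrite divr_gt0.
have [N hN] := xP _ e2; have [M hM] := yP _ e2.
exists (maxn N M) => n; rewrite geq_max => /andP[Nn Mn].
apply: le_trans (opnormD _ _) _; rewrite [leRHS]splitr; apply: lerD.
  exact: hN.
by apply: le_trans (opnormN _) _; exact: hM.
Qed.

HB.instance Definition _ :=
  GRing.isZmodClosed.Build qlseq ql_null ql_null_zmod.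

Fact ql_null_scale (a : C) (x : qlseq) :
  x \in ql_null -> ql_scale a x \in ql_null.
Proof.
move=> /asboolP xP; apply/asboolP => e e0; pose k := complex.Re `|a| + 1.
have k0 : 0 < k by rewrite ltr_pwDr // normc_def /= sqrtr_ge0.
have [N hN] := xP _ (divr_gt0 e0 k0); exists N => n Nn.
apply: le_trans (opnormZ _ _) _.
apply: le_trans (_ : k * (e / k) <= _); last by rewrite mulrC divfK ?gt_eqF.
apply: ler_pM; [|exact: opnorm_ge0|by rewrite lerDl|exact: hN].
by rewrite normc_def /= sqrtr_ge0.
Qed.

Fact ql_null_adj (x : qlseq) : x \in ql_null -> ql_adj x \in ql_null.
Proof.
move=> /asboolP xP; apply/asboolP => e e0; have [N hN] := xP _ e0.
by exists N => n Nn; apply: le_trans (opnormH _) _; exact: hN.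
Qed.

Fact ql_null_mull (x y : qlseq) : x \in ql_null -> ql_mul x y \in ql_null.
Proof.
move=> /asboolP xP; apply/asboolP => e e0; have [b b0 [B hB]] := ql_bounded y.
have [N hN] := xP _ (divr_gt0 e0 b0).
exists (maxn N B) => n; rewrite geq_max => /andP[Nn Bn].
apply: le_trans (opnormM _ _) _; rewrite -[leRHS](divfK (lt0r_neq0 b0)).
by apply: ler_pM; [exact: opnorm_ge0|exact: opnorm_ge0|exact: hN|exact: hB].
Qed.

Fact ql_null_mulr (x y : qlseq) : y \in ql_null -> ql_mul x y \in ql_null.
Proof.
move=> /asboolP yP; apply/asboolP => e e0; have [b b0 [B hB]] := ql_bounded x.
have [N hN] := yP _ (divr_gt0 e0 b0).
exists (maxn N B) => n; rewrite geq_max => /andP[Nn Bn].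
apply: le_trans (opnormM _ _) _; rewrite -[leRHS](divfK (lt0r_neq0 b0)) mulrC.
by apply: ler_pM; [exact: opnorm_ge0|exact: opnorm_ge0|exact: hN|exact: hB].
Qed.

(* B_N, the C*-norm completion of the union of the B_[1,n]: quasi-local sequences
   modulo norm-null ones, with entrywise operations. The class of (x_n) is the
   norm limit of the x_n. *)
Definition qlalg := Quotient.quot ql_null.
HB.instance Definition _ := GRing.Zmodule.on qlalg.
HB.instance Definition _ := EqQuotient.on qlalg.

Local Notation cl := (\pi_qlalg).

Fact cl_eq (x y : qlseq) : x - y \in ql_null -> cl x = cl y.
Proof. by rewrite Quotient.idealrBE => /eqP. Qed.

Fact cl_repr (x : qlseq) : repr (cl x) - x \in ql_null.
Proof. by rewrite Quotient.idealrBE reprK. Qed.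

Fact clD (x y : qlseq) : cl (x + y) = cl x + cl y.
Proof. exact: pi_addr. Qed.

Definition qla_scale (a : C) (x : qlalg) : qlalg := cl (ql_scale a (repr x)).
Definition qla_adj (x : qlalg) : qlalg := cl (ql_adj (repr x)).
Definition qla_mul (x y : qlalg) : qlalg := cl (ql_mul (repr x) (repr y)).
Definition qla_one : qlalg := cl ql_one.

Fact cl_scale a x : qla_scale a (cl x) = cl (ql_scale a x).
Proof.
apply: cl_eq; have -> : ql_scale a (repr (cl x)) - ql_scale a x =
    ql_scale a (repr (cl x) - x).
  by apply: qlseq_eq => n; exact: esym (scalerBr _ _ _).
exact: ql_null_scale (cl_repr x).
Qed.

Fact cl_adj x : qla_adj (cl x) = cl (ql_adj x).
Proof.
apply: cl_eq; have -> : ql_adj (repr (cl x)) - ql_adj x =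
    ql_adj (repr (cl x) - x).
  by apply: qlseq_eq => n; apply/matrixP => i j; rewrite !mxE rmorphB.
exact: ql_null_adj (cl_repr x).
Qed.

Fact cl_mul x y : qla_mul (cl x) (cl y) = cl (ql_mul x y).
Proof.
apply: cl_eq; set x' := repr (cl x); set y' := repr (cl y).
have -> : ql_mul x' y' - ql_mul x y = ql_mul (x' - x) y' + ql_mul x (y' - y).
  apply: qlseq_eq => n.
  change (x' n *m y' n - x n *m y n =
    (x' n - x n) *m y' n + x n *m (y' n - y n)).
  by rewrite mulmxBl mulmxBr addrA subrK.
by apply: rpredD; [apply: ql_null_mull|apply: ql_null_mulr]; exact: cl_repr.
Qed.

Fact qla_scaleA a b x : qla_scale a (qla_scale b x) = qla_scale (a * b) x.
Proof.
elim/quotW: x => x; rewrite (cl_scale b) !cl_scale; congr cl.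
by apply: qlseq_eq => n; exact: scalerA.
Qed.
Fact qla_scale1 : left_id 1 qla_scale.
Proof.
elim/quotW=> x; rewrite cl_scale; congr cl.
by apply: qlseq_eq => n; exact: scale1r.
Qed.
Fact qla_scaleDr : right_distributive qla_scale +%R.
Proof.
move=> a; elim/quotW=> x; elim/quotW=> y; rewrite -clD !cl_scale -clD; congr cl.
by apply: qlseq_eq => n; exact: scalerDr.
Qed.
Fact qla_scaleDl x : {morph qla_scale^~ x : a b / a + b}.
Proof.
move=> a b; elim/quotW: x => x; rewrite !cl_scale -clD; congr cl.
by apply: qlseq_eq => n; exact: scalerDl.
Qed.

HB.instance Definition _ := GRing.Zmodule_isLmodule.Build C qlalg
  qla_scaleA qla_scale1 qla_scaleDr qla_scaleDl.

Fact qla_scaleE a (x : qlalg) : a *: x = qla_scale a x. Proof. by []. Qed.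

Fact qla_mulA : associative qla_mul.
Proof.
elim/quotW=> x; elim/quotW=> y; elim/quotW=> z; rewrite (cl_mul y) (cl_mul x y) !cl_mul; congr cl.
by apply: qlseq_eq => n; exact: mulmxA.
Qed.
Fact qla_mul1l : left_id qla_one qla_mul.
Proof.
elim/quotW=> x; rewrite cl_mul; congr cl.
by apply: qlseq_eq => n; exact: mul1mx.
Qed.
Fact qla_mul1r : right_id qla_one qla_mul.
Proof.
elim/quotW=> x; rewrite cl_mul; congr cl.
by apply: qlseq_eq => n; exact: mulmx1.
Qed.
Fact qla_mulDl : left_distributive qla_mul +%R.
Proof.
elim/quotW=> x; elim/quotW=> y; elim/quotW=> z; rewrite -clD !cl_mul -clD.
by congr cl; apply: qlseq_eq => n; exact: mulmxDl.
Qed.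
Fact qla_mulDr : right_distributive qla_mul +%R.
Proof.
elim/quotW=> x; elim/quotW=> y; elim/quotW=> z; rewrite -clD !cl_mul -clD.
by congr cl; apply: qlseq_eq => n; exact: mulmxDr.
Qed.
Fact qla_mulZl (a : C) x y : qla_mul (a *: x) y = a *: qla_mul x y.
Proof.
elim/quotW: x => x; elim/quotW: y => y; rewrite !qla_scaleE (cl_mul x y) !cl_scale cl_mul.
by congr cl; apply: qlseq_eq => n; exact: esym (scalemxAl _ _ _).
Qed.
Fact qla_mulZr (a : C) x y : qla_mul x (a *: y) = a *: qla_mul x y.
Proof.
elim/quotW: x => x; elim/quotW: y => y; rewrite !qla_scaleE (cl_mul x y) !cl_scale cl_mul.
by congr cl; apply: qlseq_eq => n; exact: esym (scalemxAr _ _ _).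
Qed.
Fact qla_adjK : involutive qla_adj.
Proof.
elim/quotW=> x; rewrite (cl_adj x) cl_adj; congr cl.
by apply: qlseq_eq => n; exact: adjK.
Qed.
Fact qla_adjD : {morph qla_adj : x y / x + y}.
Proof.
elim/quotW=> x; elim/quotW=> y; rewrite -clD !cl_adj -clD; congr cl.
by apply: qlseq_eq => n; exact: adjD.
Qed.
Fact qla_adjZ (a : C) x : qla_adj (a *: x) = a^* *: qla_adj x.
Proof.
elim/quotW: x => x; rewrite !qla_scaleE cl_scale (cl_adj x) cl_adj cl_scale; congr cl.
by apply: qlseq_eq => n; exact: adjZ.
Qed.
Fact qla_adjM x y : qla_adj (qla_mul x y) = qla_mul (qla_adj y) (qla_adj x).
Proof.
elim/quotW: x => x; elim/quotW: y => y; rewrite (cl_mul x y) (cl_adj x) (cl_adj y) cl_adj cl_mul; congr cl.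
by apply: qlseq_eq => n; exact: adjM.
Qed.

HB.instance Definition _ := isStarAlgebra.Build C qlalg
  qla_mulA qla_mul1l qla_mul1r qla_mulDl qla_mulDr qla_mulZl qla_mulZr
  qla_adjK qla_adjD qla_adjZ qla_adjM.

(* X (x) 1 in B_[1,n], set to 0 when n < m. *)
Definition extend m n (X : obs R d m) : obs R d n :=
  if boolP (m <= n)%N is AltTrue le_mn then amplify le_mn X else 0.

Fact extendE m n (le_mn : (m <= n)%N) (X : obs R d m) :
  extend n X = amplify le_mn X.
Proof.
rewrite /extend; case: {-}_ / boolP => [h|]; last by rewrite le_mn.
by rewrite (bool_irrelevance h le_mn).
Qed.

Fact ql_extendP m (X : obs R d m) : ql_cauchy (fun n => extend n X).
Proof.
move=> e e0; exists m => n p le_np le_mn.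
by rewrite (extendE le_mn) (extendE (leq_trans le_mn le_np))
  (amplify_comp _ _ (leq_trans le_mn le_np)) subrr opnorm0 ltW.
Qed.

(* The inclusion of B_[1,m] in B_N. *)
Definition local_embed m (X : obs R d m) : qlalg := cl (QlSeq (ql_extendP X)).

End CauchySequence.

Arguments qlalg R d : clear implicits.

Section MatrixProduct.
Variables (R : realType) (d D : nat).
Local Notation C := R[i].

(* [A n i] is the matrix A_i^[n] of site n >= 1; [A 0] is never used. *)
Variable A : nat -> 'I_d -> 'M[C]_D.

Definition mpv n : 'cV[C]_#|config d n| :=
  \col_a \tr (\prod_(k < n) A k.+1 ((enum_val a : config d n) k)).

(* <Psi_n|X|Psi_n> / <Psi_n|Psi_n> *)
Definition mp_expect n (X : obs R d n) : C :=
  ((mpv n)^H *m X *m mpv n) 0 0 / ((mpv n)^H *m mpv n) 0 0.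

Definition transfer n (M : 'M[C]_D) : 'M[C]_D :=
  \sum_(i < d) (A n i)^H *m M *m A n i.

Definition hatmap n (X : obs R d n) (M : 'M[C]_D) : 'M[C]_D :=
  \sum_(i : config d n) \sum_(j : config d n)
    X (enum_rank i) (enum_rank j) *:
      ((\prod_(k < n) (A (rev_ord k).+1 (i (rev_ord k)))^H) *m M *m
       (\prod_(k < n) A k.+1 (j k))).

End MatrixProduct.

Section Superoperators.
Variables (C : numClosedFieldType) (D : nat).

(* [delta_mx k l] is |e_k><e_l|. *)
Definition supertrace (Phi : 'M[C]_D -> 'M[C]_D) : C :=
  \sum_(k < D) \sum_(l < D) Phi (delta_mx k l) k l.

Definition psdmx n (M : 'M[C]_n) : Prop :=
  forall v : 'cV[C]_n, 0 <= (v^H *m M *m v) 0 0.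

(* id_k (x) Phi on M_k (x) M_D, seen as k x k block matrices over M_D. *)
Definition id_tens k (Phi : 'M[C]_D -> 'M[C]_D) (M : 'M[C]_(k * D)) :
    'M[C]_(k * D) :=
  \matrix_(s, t)
    let block := \matrix_(a, b) M (mxtens_index ((mxtens_unindex s).1, a))
                                  (mxtens_index ((mxtens_unindex t).1, b)) in
    Phi block (mxtens_unindex s).2 (mxtens_unindex t).2.

Definition completely_positive (Phi : {linear 'M[C]_D -> 'M[C]_D}) : Prop :=
  forall k (M : 'M[C]_(k * D)), psdmx M -> psdmx (id_tens Phi M).

End Superoperators.

Definition projective (R : realType) (d : nat)
    (phi : forall n, obs R d n -> R[i]) : Prop :=
  forall n, (0 < n)%N -> is_state (phi n) /\
    forall X : obs R d n, phi n.+1 (amplify (leqnSn n) X) = phi n X.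

(* Main.v *)
(* Contracting the tensor identity with M gives, for every i,
   Phi_(n+1) (A_i^[n]^H M A_i^[n]) = A_i^[n]^H M A_i^[n], so that
   Phi_(n+1) o Phi_n = Phi_n as maps and (1) is immediate. Since
   <Psi_n|X|Psi_n> is the supertrace of hat X, and appending a site composes
   hat X with the transfer map of that site, the expectation of a fixed local X
   is constant once n > N, with normalisation Tr Phi_1; this gives (2) and the
   limit in (3). The resulting functionals are bounded by the operator norm
   (Cauchy-Schwarz), so on a quasi-local sequence they form a Cauchy sequence of
   complex numbers, whose limit is the state on B_N. *)

Require Import Defs.
From HB Require Import structures.
From mathcomp Require Import all_boot all_order all_algebra.
From mathcomp Require Import complex mxtens.
From mathcomp Require Import all_classical all_reals all_analysis.

Set Implicit Arguments.
Unset Strict Implicit.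
Unset Printing Implicit Defensive.

Import Order.TTheory GRing.Theory Num.Theory.
Import numFieldNormedType.Exports.

Local Open Scope ring_scope.
Local Open Scope classical_set_scope.

(** * Two-sided multiplication maps: tensor form and supertrace *)

Section Sandwich.
Variables (C : numClosedFieldType) (D : nat).
Implicit Types P Q M : 'M[C]_D.

Lemma sandwich_tens P Q M a e :
  (P *m M *m Q) a e =
  \sum_b \sum_c M b c * (P *t Q) (mxtens_index (a, c)) (mxtens_index (b, e)).
Proof.
rewrite mxE exchange_big /=; apply: eq_bigr => c _.
rewrite mxE mulr_suml; apply: eq_bigr => b _.
by rewrite tensmxE mulrCA mulrA.
Qed.

(** The map [M |-> P M Q] depends on [P] and [Q] only through [P *t Q], and linearly so; a tensor
    identity thus becomes an identity of maps. *)
Lemma sum_sandwich (I : finType) (F G : I -> 'M[C]_D) P Q M :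
  \sum_j F j *t G j = P *t Q -> \sum_j F j *m M *m G j = P *m M *m Q.
Proof.
move=> FG; apply/matrixP => a e; rewrite summxE sandwich_tens -FG.
under eq_bigr do rewrite sandwich_tens.
rewrite exchange_big; apply: eq_bigr => b _ /=.
by rewrite exchange_big; apply: eq_bigr => c _ /=; rewrite summxE mulr_sumr.
Qed.

Lemma sandwich_delta P Q k l : (P *m delta_mx k l *m Q) k l = P k k * Q l l.
Proof.
(* The matrix unit is split as column times row, so the entry factors. *)
rewrite -(mul_delta_mx (0 : 'I_1) k l) mulmxA -mulmxA -colE -rowE.
by rewrite mxE big_ord1 !mxE.
Qed.

Lemma supertrace_sandwich P Q :
  supertrace (fun M => P *m M *m Q) = \tr P * \tr Q.
Proof.
rewrite mulr_suml; apply: eq_bigr => k _; rewrite mulr_sumr.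
by apply: eq_bigr => l _; rewrite sandwich_delta.
Qed.

Lemma eq_supertrace (Phi Psi : 'M[C]_D -> 'M[C]_D) :
  Phi =1 Psi -> supertrace Phi = supertrace Psi.
Proof. by move=> e; do 2!apply: eq_bigr => ? _; rewrite e. Qed.

Lemma adjmx_prod n (B : 'I_n -> 'M[C]_D) :
  (\prod_(k < n) B k)^H = \prod_(k < n) (B (rev_ord k))^H.
Proof.
elim: n B => [|n IHn] B; first by rewrite !big_ord0 trmx1 map_mx1.
rewrite big_ord_recr big_ord_recl /= trmx_mul map_mxM IHn.
congr ((B _)^H * _); first by apply: val_inj; rewrite /= subn1.
apply: eq_bigr => k _; congr ((B _)^H); apply: val_inj => /=.
by rewrite /bump /= add1n subSS.
Qed.

End Sandwich.

(** * Expectation functionals of a single vector *)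

Section VectorFunctional.
Variables (R : realType) (m : nat) (v : 'cV[R[i]]_m).
Local Notation C := R[i].
Implicit Types X Y : 'M[C]_m.

(** At [v := mpv A n] this unfolds to [mp_expect A]. *)
Definition vec_expect X : C := (v^H *m X *m v) 0 0 / (v^H *m v) 0 0.

Lemma vec_expect_scalar : scalar vec_expect.
Proof.
move=> a X Y; rewrite /vec_expect mulmxDr mulmxDl -scalemxAr -scalemxAl.
move: (v^H *m X *m v) (v^H *m Y *m v) (v^H *m v) => x y z.
by rewrite mxE [X in (X + _) / _]mxE mulrDl mulrA.
Qed.

Lemma vec_expect_ge0 X : 0 <= vec_expect (X^H *m X).
Proof.
have sq0 n (w : 'cV[C]_n) : 0 <= (w^H *m w) 0 0.
  by rewrite vnorm_sumE sumr_ge0 // => i _; exact: exprn_ge0.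
apply: divr_ge0 => //; rewrite mulmxA -mulmxA.
have -> : v^H *m X^H = (X *m v)^H by rewrite trmx_mul map_mxM.
exact: sq0.
Qed.

Hypothesis v_neq0 : (v^H *m v) 0 0 != 0.

Lemma vec_expect1 : vec_expect 1%:M = 1.
Proof. by rewrite /vec_expect mulmx1 divff. Qed.

Lemma vec_expect_le X : `|vec_expect X| <= (opnorm X)%:C%C.
Proof.
have vv : (v^H *m v) 0 0 = (vnorm v ^+ 2)%:C%C by rewrite vnorm_sqr vnorm_sumE.
rewrite /vec_expect -mulmxA normrM normfV vv.
have v0 : 0 < (vnorm v ^+ 2)%:C%C :> C.
  by rewrite lt_def -vv v_neq0 vv ler0c exprn_ge0 ?vnorm_ge0.
rewrite [`|(_ ^+ 2)%:C%C|]gtr0_norm // ler_pdivrMr //.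
have cs : `|(v^H *m (X *m v)) 0 0| <= (vnorm v * vnorm (X *m v))%:C%C.
  rewrite rmorphM /= !vnormE.
  (* [dotmx] pairs row vectors and conjugates its second argument, hence the transposes and the
     swap. *)
  have tr (a b : 'cV[C]_m) : (a^H *m b) 0 0 = dotmx b^T a^T.
    by rewrite dotmxE trmxK !mxE; apply: eq_bigr => i _; rewrite !mxE mulrC.
  rewrite !tr; have [+ _] := CauchySchwarz_sqrt (@dotmx C m) (X *m v)^T v^T.
  by rewrite mulrC.
apply: le_trans cs _; rewrite -rmorphM lecR expr2 mulrCA.
by rewrite ler_wpM2l ?vnorm_ge0 ?vnorm_mulmx.
Qed.

End VectorFunctional.

(** * Matrix product vectors and the effect of appending one site *)

Section MatrixProduct.
Variables (R : realType) (d D : nat) (A : nat -> 'I_d -> 'M[R[i]]_D).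
Local Notation C := R[i].

Lemma sum_config n (F : 'I_#|config d n| -> C) :
  \sum_a F a = \sum_i F (enum_rank i).
Proof. by rewrite (reindex _ (onW_bij _ (@enum_rank_bij _))). Qed.

Lemma mpv_enum_rank n (i : config d n) :
  mpv A n (enum_rank i) 0 = \tr (\prod_(k < n) A k.+1 (i k)).
Proof. by rewrite mxE enum_rankK. Qed.

(** A bra coefficient times a ket coefficient is a product of two traces, that is, the supertrace of
    a two-sided multiplication; weighting by the entries of [X] assembles [hatmap A X]. *)
Lemma mpv_supertrace n (X : obs R d n) :
  ((mpv A n)^H *m X *m mpv A n) 0 0 = supertrace (hatmap A X).
Proof.
rewrite -mulmxA mxE sum_config.
transitivity (\sum_i \sum_j X (enum_rank i) (enum_rank j) *
    supertrace (fun M => (\prod_(k < n) (A (rev_ord k).+1 (i (rev_ord k)))^H)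
      *m M *m (\prod_(k < n) A k.+1 (j k)))); last first.
  (* This branch only moves the supertrace past the two sums of [hatmap]. *)
  rewrite /supertrace /hatmap; under [RHS]eq_bigr do under eq_bigr do
    rewrite summxE.
  under [RHS]eq_bigr do rewrite exchange_big.
  rewrite [RHS]exchange_big; apply: eq_bigr => i _ /=.
  under [RHS]eq_bigr do under eq_bigr do rewrite summxE.
  under [RHS]eq_bigr do rewrite exchange_big.
  rewrite [RHS]exchange_big; apply: eq_bigr => j _ /=.
  rewrite mulr_sumr; apply: eq_bigr => k _; rewrite mulr_sumr.
  by apply: eq_bigr => l _; rewrite [RHS]mxE.
apply: eq_bigr => i _; rewrite [X in _ * X]mxE sum_config mulr_sumr.
apply: eq_bigr => j _; rewrite mpv_enum_rank supertrace_sandwich.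
rewrite -(adjmx_prod (fun k : 'I_n => A k.+1 (i k))).
rewrite trace_map_mx mxtrace_tr mxE [X in Num.conj X]mxE mpv_enum_rank.
by rewrite mulrCA mulrA.
Qed.

(** Coordinates in which the last site is split off, so that sums over n+1 sites become double
    sums. *)
Definition rcons_config n (x : config d n * 'I_d) : config d n.+1 :=
  [ffun k : 'I_n.+1 => if unlift ord_max k is Some k' then x.1 k' else x.2].

Lemma rcons_config_max n (x : config d n * 'I_d) : rcons_config x ord_max = x.2.
Proof. by rewrite ffunE unlift_none. Qed.

Lemma rcons_config_widen n (x : config d n * 'I_d) (k : 'I_n) le_n :
  rcons_config x (widen_ord (le_n : (n <= n.+1)%N) k) = x.1 k.
Proof.
have -> : widen_ord le_n k = lift ord_max k.
  by apply: val_inj; rewrite /= /bump leqNgt ltn_ord.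
by rewrite ffunE liftK.
Qed.

Lemma restrict_rcons n le_n (x : config d n * 'I_d) :
  Defs.restrict (le_n : (n <= n.+1)%N) (rcons_config x) = x.1.
Proof. by apply/ffunP => k; rewrite ffunE rcons_config_widen. Qed.

Lemma rcons_config_bij n : bijective (@rcons_config n).
Proof.
exists (fun i : config d n.+1 => (Defs.restrict (leqnSn n) i, i ord_max)) => [x|i].
  by rewrite restrict_rcons rcons_config_max -surjective_pairing.
apply/ffunP => k; rewrite ffunE; case: unliftP => [k' ->|-> //]; rewrite ffunE.
by congr (i _); apply: val_inj; rewrite /= /bump leqNgt ltn_ord.
Qed.

Lemma amplify_rcons n (X : obs R d n) (x y : config d n * 'I_d) le_n :
  amplify (le_n : (n <= n.+1)%N) X (enum_rank (rcons_config x))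
    (enum_rank (rcons_config y)) =
  X (enum_rank x.1) (enum_rank y.1) * (x.2 == y.2)%:R.
Proof.
rewrite amplifyE !restrict_rcons; congr (_ * _%:R); congr nat_of_bool.
apply/forallP/eqP => [/(_ ord_max)|xy k].
  by rewrite leqnn !rcons_config_max => /eqP.
apply/implyP => nk; suff -> : k = ord_max by rewrite !rcons_config_max xy.
by apply: val_inj; apply/eqP; rewrite eqn_leq nk -ltnS ltn_ord.
Qed.

Lemma transfer_sum n (I : finType) (F : I -> 'M[C]_D) :
  transfer A n (\sum_i F i) = \sum_i transfer A n (F i).
Proof.
rewrite /transfer exchange_big; apply: eq_bigr => j _ /=.
by rewrite mulmx_sumr mulmx_suml.
Qed.

Lemma transferZ n a (M : 'M[C]_D) : transfer A n (a *: M) = a *: transfer A n M.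
Proof.
rewrite /transfer scaler_sumr; apply: eq_bigr => j _.
by rewrite -scalemxAr -scalemxAl.
Qed.

(** The new site contributes the outermost factors on both sides, and the identity acting there
    forces equal bra and ket labels; the sum over the common label is the transfer map. *)
Lemma hatmap_amplifyS n (X : obs R d n) le_n (M : 'M[C]_D) :
  hatmap A (amplify (le_n : (n <= n.+1)%N) X) M =
  transfer A n.+1 (hatmap A X M).
Proof.
rewrite /hatmap; have bij := onW_bij _ (@rcons_config_bij n).
have prodR x : \prod_(k < n.+1) A k.+1 (rcons_config x k) =
    \prod_(k < n) A k.+1 (x.1 k) * A n.+1 x.2.
  rewrite big_ord_recr rcons_config_max; congr (_ * _).
  by apply: eq_bigr => k _; rewrite rcons_config_widen.
have prodH x :
    \prod_(k < n.+1) (A (rev_ord k).+1 (rcons_config x (rev_ord k)))^H =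
    (A n.+1 x.2)^H * \prod_(k < n) (A (rev_ord k).+1 (x.1 (rev_ord k)))^H.
  rewrite -(adjmx_prod (fun k : 'I_n => A k.+1 (x.1 k))).
  rewrite -(adjmx_prod (fun k : 'I_n.+1 => A k.+1 (rcons_config x k))).
  by rewrite prodR trmx_mul map_mxM.
have split (G : config d n * 'I_d -> 'M[C]_D) :
    \sum_x G x = \sum_p \sum_a G (p, a).
  by rewrite pair_big; apply: eq_bigr => -[].
rewrite (reindex _ (bij _)) split transfer_sum /=; apply: eq_bigr => p _.
under eq_bigr do rewrite (reindex _ (bij _)) split /=.
rewrite exchange_big transfer_sum; apply: eq_bigr => q _ /=.
rewrite exchange_big transferZ scaler_sumr /=.
apply: eq_bigr => b _; rewrite (bigD1 b) //= [X in _ + X]big1 ?addr0; last first.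
  by move=> a /negbTE ab; rewrite amplify_rcons ab mulr0 scale0r.
by rewrite amplify_rcons eqxx mulr1 prodH prodR -!mulmxE !mulmxA.
Qed.

End MatrixProduct.

(** * Completeness of the complex numbers and limits of nonnegative sequences *)

Section ComplexCauchy.
Variable R : realType.
Local Notation C := R[i].

Lemma normc_ge_Im (z : C) : `|complex.Im z|%:C%C <= `|z|.
Proof.
by rewrite normc_def lecR -sqrtr_sqr ler_wsqrtr // lerDr sqr_ge0.
Qed.

Lemma complex_cauchy_cvg (u : nat -> C) :
  (forall e : R, 0 < e -> exists N, forall n, (N <= n)%N ->
     `|u n - u N| <= e%:C%C) ->
  exists l : C, (u : nat -> C^o) @ \oo --> (l : C^o).
Proof.
move=> cu.
(* Real and imaginary parts are handled together, as additive maps bounded by the modulus. *)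
have part (f : {additive C -> R}) : (forall z, `|f z|%:C%C <= `|z|) ->
    exists r : R, (f \o u) @ \oo --> r.
  move=> fle; apply/cvg_ex/cauchy_cvgP/cauchyP => e e0.
  have [N uN] := cu _ (divr_gt0 e0 (ltr0n _ 2)).
  exists (f (u N)); exists N => // n Nn /=; rewrite /ball /= distrC -raddfB.
  apply: le_lt_trans (_ : e / 2 < e); last by rewrite gtr_pMr // invf_lt1 ?ltr1n.
  by rewrite -lecR; apply: le_trans (fle _) _; exact: uN.
have [r ur] := part (@complex.Re R) (@normc_ge_Re _).
have [s us] := part (@complex.Im R) normc_ge_Im.
exists (r%:C + 'i * s%:C)%C; apply/cvgrPdist_le => e e0.
(* The tolerance is a positive element of [R[i]], hence real. *)
have eE : e = (complex.Re e)%:C%C by rewrite RRe_real // gtr0_real.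
have e2 : 0 < complex.Re e / 2 by rewrite divr_gt0 // -ltcR -eE.
move/cvgrPdist_le/(_ _ e2) : ur => ur; move/cvgrPdist_le/(_ _ e2) : us => us.
apply: filterS2 ur us => n /= rn sn; rewrite [u n]complexE opprD addrACA -mulrBr.
rewrite -!rmorphB (le_trans (ler_normD _ _)) // eE [leRHS]splitr.
have -> : (complex.Re e)%:C%C / 2 = (complex.Re e / 2)%:C%C.
  by rewrite rmorphM /= fmorphV rmorph_nat.
have absC (x : R) : `|x%:C%C| = `|x|%:C%C.
  by rewrite normc_def /= expr0n addr0 sqrtr_sqr.
have normi : `|'i%C| = 1 :> C by rewrite normc_def /= expr0n expr1n add0r sqrtr1.
by rewrite normrM normi mul1r !absC lerD ?lecR.
Qed.

(** The terms eventually equal their moduli, so the sequence also tends to [|l|]; uniqueness of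
    limits gives [|l| = l]. *)
Lemma cvg_ge0_complex (u : nat -> C) (l : C) : (\forall n \near \oo, 0 <= u n) ->
  (u : nat -> C^o) @ \oo --> (l : C^o) -> 0 <= l.
Proof.
move=> u0 ul; suff <- : `|l| = l by exact: normr_ge0.
have nl : (u : nat -> C^o) @ \oo --> (`|l| : C^o).
  apply: cvg_trans (cvg_norm ul); apply: near_eq_cvg.
  by apply: filterS u0 => n /ger0_norm.
exact: (cvg_unique (@norm_hausdorff _ C^o) nl ul).
Qed.

End ComplexCauchy.

(** * From a bounded projective family to a state on the quasi-local algebra *)

Section ProjectiveLimit.
Variables (R : realType) (d : nat) (phi : forall n, obs R d n -> R[i]).
Local Notation C := R[i].
Hypothesis phi_proj : projective phi.
Hypothesis phi_le : forall n (X : obs R d n), (0 < n)%N ->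
  `|phi X| <= (opnorm X)%:C%C.

Lemma projective_amplify m n (le_mn : (m <= n)%N) (X : obs R d m) :
  (0 < m)%N -> phi (amplify le_mn X) = phi X.
Proof.
move=> m0; elim: n le_mn => [|n IHn] le_mn.
  by have := leq_trans m0 le_mn.
have := le_mn; rewrite leq_eqVlt => /predU1P[mn|].
  by subst m; rewrite amplify_id.
rewrite ltnS => le_mn'; rewrite -(amplify_comp le_mn' (leqnSn n)).
by rewrite (phi_proj (leq_trans m0 le_mn')).2 IHn.
Qed.

Definition proj_lim (x : qlseq R d) (l : C) :=
  ((fun n => phi (x n)) : nat -> C^o) @ \oo --> (l : C^o).

Lemma proj_lim_unique x l l' : proj_lim x l -> proj_lim x l' -> l = l'.
Proof. exact: (cvg_unique (@norm_hausdorff _ C^o)). Qed.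

Lemma projective_sub n (X Y : obs R d n) : (0 < n)%N -> phi (X - Y) = phi X - phi Y.
Proof.
move=> n0; have [lin _ _] := (phi_proj n0).1.
by rewrite -scaleN1r addrC lin mulN1r addrC.
Qed.

(** By projectivity, [phi (x n) - phi (x N)] is [phi] of [x n - x N (x) 1], which the norm bound
    controls. *)
Lemma proj_lim_ex x : exists l, proj_lim x l.
Proof.
apply: complex_cauchy_cvg => e e0; have [N xN] := qlvalP x e0.
(* The maximum with 1 keeps the index positive, where projectivity and the bound are stated. *)
exists (maxn N 1) => n le_n.
rewrite -(projective_amplify le_n) ?leq_maxr // -projective_sub; last first.
  by apply: leq_trans le_n; exact: leq_maxr.
apply: le_trans (phi_le _ _) _; first by apply: leq_trans le_n; exact: leq_maxr.
by rewrite lecR; apply: xN; exact: leq_maxl.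
Qed.

(** Makes the limit independent of the representative of a class. *)
Lemma proj_lim_null x y l : x - y \in @ql_null R d -> proj_lim y l -> proj_lim x l.
Proof.
move=> /asboolP xy yl; apply: cvg_sub0 yl; apply/cvgrPdist_le => e e0.
have eE : e = (complex.Re e)%:C%C by rewrite RRe_real // gtr0_real.
have re0 : 0 < complex.Re e by rewrite -ltcR -eE.
have [N hN] := xy _ re0.
exists (maxn N 1) => // n /=; rewrite geq_max => /andP[Nn n0].
rewrite sub0r normrN; change (`|phi (x n) - phi (y n)| <= e); rewrite -projective_sub //.
by apply: le_trans (phi_le _ n0) _; rewrite eE lecR; exact: hN.
Qed.

Definition proj_state (x : qlalg R d) : C := sval (cid (proj_lim_ex (repr x))).

Lemma proj_stateE (x : qlseq R d) l : proj_lim x l ->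
  proj_state (\pi_(qlalg R d)%qT x) = l.
Proof.
move=> xl; rewrite /proj_state; case: cid => l' /= xl'.
exact: proj_lim_unique xl' (proj_lim_null (cl_repr x) xl).
Qed.

(** Operations on classes are entrywise and each [phi n] with n positive is a state, so all three
    properties pass to the limit. *)
Lemma proj_state_is_state : is_state proj_state.
Proof.
split=> [a x y|x|].
- elim/quotW: x => x; elim/quotW: y => y.
  have [k xk] := proj_lim_ex x; have [l yl] := proj_lim_ex y.
  rewrite (proj_stateE xk) (proj_stateE yl) qla_scaleE cl_scale -clD.
  apply: proj_stateE.
  apply: cvg_trans (cvgD (cvgZl_tmp (k := a) xk) yl).
  apply: near_eq_cvg; exists 1%N => // n /= n0.
  by have [lin _ _] := (phi_proj n0).1; rewrite [RHS]lin.
- elim/quotW: x => x.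
  have [l xl] := proj_lim_ex (ql_mul (ql_adj x) x).
  have -> : amul (adj (\pi_(qlalg R d)%qT x)) (\pi_(qlalg R d)%qT x) =
      \pi_(qlalg R d)%qT (ql_mul (ql_adj x) x).
    by rewrite -cl_mul -cl_adj.
  rewrite (proj_stateE xl); apply: cvg_ge0_complex xl.
  by exists 1%N => // n /= n0; have [_ pos _] := (phi_proj n0).1; exact: pos.
apply: proj_stateE; apply: cvg_near_cst.
by exists 1%N => // n /= n0; have [_ _ one] := (phi_proj n0).1.
Qed.

Lemma proj_state_local m (X : obs R d m) : (0 < m)%N ->
  proj_state (local_embed X) = phi X.
Proof.
move=> m0; apply: proj_stateE; apply: cvg_near_cst; exists m => // n /= le_mn.
by rewrite (extendE le_mn) projective_amplify.
Qed.

End ProjectiveLimit.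

(** * Consequences of the tensor identity for transfer maps and expectations *)

Section StationaryTransfer.
Variables (R : realType) (d D : nat) (A : nat -> 'I_d -> 'M[R[i]]_D).
Local Notation C := R[i].
Hypothesis hA : forall (n : nat) (i : 'I_d), (0 < n)%N ->
  \sum_(j < d) ((A n.+1 j)^H *m (A n i)^H) *t (A n i *m A n.+1 j)
    = (A n i)^H *t A n i.

Lemma transfer_transfer n (M : 'M[C]_D) : (0 < n)%N ->
  transfer A n.+1 (transfer A n M) = transfer A n M.
Proof.
move=> n0; rewrite {2}/transfer transfer_sum; apply: eq_bigr => i _.
rewrite -[RHS](sum_sandwich M (hA i n0)); apply: eq_bigr => j _.
by rewrite !mulmxA.
Qed.

(** The first appended site contributes its transfer map; every later one is absorbed by
    [transfer_transfer]. *)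
Lemma hatmap_amplify m n (le_mn : (m <= n)%N) (X : obs R d m) (M : 'M[C]_D) :
  (m < n)%N -> hatmap A (amplify le_mn X) M = transfer A m.+1 (hatmap A X M).
Proof.
elim: n le_mn => // n IHn le_mn; rewrite ltnS leq_eqVlt => /predU1P[mn|lt_mn].
  by subst n; rewrite hatmap_amplifyS.
rewrite -(IHn (ltnW lt_mn)) // -(amplify_comp (ltnW lt_mn) (leqnSn n)).
(* Peeling one more site on both sides brings two consecutive transfer maps together. *)
rewrite hatmap_amplifyS; case: n lt_mn {IHn le_mn} => // n lt_mn.
have le_mn : (m <= n)%N by [].
rewrite -(amplify_comp le_mn (leqnSn n)) hatmap_amplifyS.
exact: transfer_transfer.
Qed.

Lemma hatmap_empty (M : 'M[C]_D) : hatmap A (1%:M : obs R d 0) M = M.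
Proof.
have /fintype1[i0 i0P] : #|config d 0| = 1%N by rewrite card_ffun !card_ord.
have i0E : xpredT =1 pred1 i0 by move=> i; rewrite /= (i0P i) eqxx.
rewrite /hatmap (big_pred1 _ i0E) (big_pred1 _ i0E).
by rewrite !big_ord0 mxE eqxx scale1r mul1mx mulmx1.
Qed.

(** The identity on n sites amplifies the identity on no site, whose [hatmap] is the identity
    map. *)
Lemma mpv_norm n : (0 < n)%N ->
  ((mpv A n)^H *m mpv A n) 0 0 = supertrace (transfer A 1).
Proof.
move=> n0; rewrite -[X in X *m _]mulmx1 -(amplify1 _ _ (leq0n n)) mpv_supertrace.
by apply: eq_supertrace => M; rewrite hatmap_amplify // hatmap_empty.
Qed.

Lemma mp_expect_amplify m n (le_mn : (m <= n)%N) (X : obs R d m) : (m < n)%N ->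
  mp_expect A (amplify le_mn X) =
  supertrace (transfer A m.+1 \o hatmap A X) / supertrace (transfer A 1).
Proof.
move=> lt_mn; rewrite /mp_expect mpv_supertrace mpv_norm ?(leq_ltn_trans _ lt_mn) //.
by congr (_ / _); apply: eq_supertrace => M; exact: hatmap_amplify.
Qed.

Lemma mp_expect_cvg m (X : obs R d m) :
  (fun n => mp_expect A (extend n X) : C^o) @ \oo -->
    (supertrace (transfer A m.+1 \o hatmap A X) / supertrace (transfer A 1) : C^o).
Proof.
(* The threshold is m+1: at n = m no transfer map has been applied yet. *)
apply: cvg_near_cst; exists m.+1 => // n /= lt_mn.
by rewrite (extendE (ltnW lt_mn)) mp_expect_amplify.
Qed.

Hypothesis mpv_neq0 : forall n, (0 < n)%N -> ((mpv A n)^H *m mpv A n) 0 0 != 0.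

(** The extra site in each functional puts both sides of the compatibility condition in the range
    where expectations are constant. *)
Lemma mp_expect_projective :
  projective (fun n (X : obs R d n) => mp_expect A (amplify (leqnSn n) X)).
Proof.
move=> n n0; split; last first.
  by move=> X; rewrite (amplify_comp _ _ (leqW (leqnSn n))) !mp_expect_amplify.
split=> [a X Y|X|].
- by rewrite amplifyD amplifyZ; exact: vec_expect_scalar.
- rewrite [amul _ _]/(X^H *m X) amplifyM amplifyH; exact: vec_expect_ge0.
by rewrite [aone]/(1%:M) amplify1; apply: vec_expect1; exact: mpv_neq0.
Qed.

Lemma mp_expect_le n (X : obs R d n) :
  `|mp_expect A (amplify (leqnSn n) X)| <= (opnorm X)%:C%C.
Proof.
apply: le_trans (vec_expect_le _ _) _; first exact: mpv_neq0.
by rewrite lecR opnorm_amplify.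
Qed.

End StationaryTransfer.

Theorem theorem4p2 (R : realType) (d D : nat)
  (A : nat -> 'I_d -> 'M[R[i]]_D)
  (d_gt0 : (0 < d)%N) (D_gt0 : (0 < D)%N)
  (hA : forall (n : nat) (i : 'I_d), (0 < n)%N ->
    \sum_(j < d) ((A n.+1 j)^H *m (A n i)^H) *t (A n i *m A n.+1 j)
      = (A n i)^H *t A n i) :
  (forall (n : nat) (Phi : {linear 'M[R[i]]_D -> 'M[R[i]]_D}), (0 < n)%N ->
     completely_positive Phi ->
     supertrace (transfer A n.+1 \o transfer A n \o Phi)
       = supertrace (transfer A n \o Phi))
  /\
  ((forall n : nat, (0 < n)%N -> ((mpv A n)^H *m mpv A n) 0 0 != 0) ->
   projective (fun (n : nat) (X : obs R d n) =>
     mp_expect A (amplify (leqnSn n) X))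
   /\
   (forall (N : nat) (X : obs R d N), (0 < N)%N ->
      (fun n : nat => mp_expect A (extend n X) : R[i]^o) @ \oo
        --> (supertrace (transfer A N.+1 \o hatmap A X)
               / supertrace (transfer A 1) : R[i]^o))
   /\
   (exists phi : qlalg R d -> R[i],
      is_state phi /\
      forall (N : nat) (X : obs R d N), (0 < N)%N ->
        phi (local_embed X) =
          lim ((fun n : nat => mp_expect A (extend n X) : R[i]^o) @ \oo))).
Proof.
split=> [n Phi n0 _|mpv_neq0].
  by apply: eq_supertrace => M; exact: transfer_transfer.
have proj := mp_expect_projective hA mpv_neq0.
have bnd n (X : obs R d n) (_ : (0 < n)%N) := mp_expect_le mpv_neq0 X.
split=> //; split=> [N X _|]; first exact: mp_expect_cvg.
exists (proj_state proj bnd); split=> [|N X N0]; first exact: proj_state_is_state.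
(* The local value is the expectation on N+1 sites, already equal to the limit. *)
rewrite proj_state_local // mp_expect_amplify //.
symmetry; apply: (cvg_lim (@norm_hausdorff _ R[i]^o)); exact: mp_expect_cvg.
Qed.
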